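(* Let $f$ be convex on $\mathcal{X}=\mathcal{X}_1\times\cdots\times\mathcal{X}_{N_b}$, let $\alpha=B/N_b$, and let $\{\gamma_t\}_{t=0,1,\ldots}$ be a predefined (deterministic) step-size sequence satisfying, for all $t\ge 0$, $$0<\gamma_t\le 1 \qquad\text{and}\qquad \frac{1-\alpha\gamma_{t+1}}{\gamma_{t+1}^2}\le \frac{1}{\gamma_t^2}.$$ Then the iterates $\{\mathbf{x}^t\}$ of the randomized block Frank-Wolfe algorithm with step sizes $\{\gamma_t\}$ satisfy, for all $t\ge 1$, $$\mathbb{E}\left[h(\mathbf{x}^t)\right]\le \frac{1-\alpha\gamma_0}{\gamma_0^2}\,\gamma_{t-1}^2\,h(\mathbf{x}^0)+\frac{t\,\bar C_f^{B}}{2}\,\gamma_{t-1}^2 .$$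
   Context: Setting. $N_b\ge 1$ is an integer, $\mathcal{N}_b=\{1,\ldots,N_b\}$, $B\in\{1,\ldots,N_b\}$, $\alpha:=B/N_b$. Vectors $\mathbf{x}\in\mathbb{R}^d$ are split into blocks $\mathbf{x}=(\mathbf{x}_1,\ldots,\mathbf{x}_{N_b})$. The feasible set is $\mathcal{X}=\mathcal{X}_1\times\cdots\times\mathcal{X}_{N_b}$, with each $\mathcal{X}_n$ nonempty, convex and compact. The objective $f$ is real-valued and differentiable on (an open set containing) $\mathcal{X}$; $\nabla_{\mathbf{x}_n}f$ denotes the partial gradient with respect to block $n$. The problem is to minimize $f$ over $\mathcal{X}$; $\mathbf{x}^*$ is a global minimizer of $f$ over $\mathcal{X}$, and $h(\mathbf{x}):=f(\mathbf{x})-f(\mathbf{x}^* )$. Randomized block Frank-Wolfe algorithm. Start from a (deterministic) $\mathbf{x}^0\in\mathcal{X}$. At iteration $t=0,1,\ldots$: draw $\mathcal{B}_t$ uniformly at random among all subsets of $\mathcal{N}_b$ with exactly $B$ elements, independently of previous draws; for each $n\in\mathcal{B}_t$ pick a minimizer $\mathbf{s}_n^t\in\arg\min_{\mathbf{s}_n\in\mathcal{X}_n}\langle \mathbf{s}_n,\nabla_{\mathbf{x}_n}f(\mathbf{x}^t)\rangle$ (ties broken arbitrarily, as a function of the draws $\mathcal{B}_0,\ldots,\mathcal{B}_t$); set $\mathbf{x}_n^{t+1}=(1-\gamma_t)\mathbf{x}_n^t+\gamma_t\mathbf{s}_n^t$ for $n\in\mathcal{B}_t$ and $\mathbf{x}_n^{t+1}=\mathbf{x}_n^t$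 for $n\notin\mathcal{B}_t$. Expectations are over the random draws. Curvature. For $\mathcal{B}\subseteq\mathcal{N}_b$, $$C_f^{\mathcal{B}}:=\sup \frac{2}{\gamma^2}\Big(f(\mathbf{y})-f(\mathbf{x})-\sum_{n\in\mathcal{B}}\langle\mathbf{y}_n-\mathbf{x}_n,\nabla_{\mathbf{x}_n}f(\mathbf{x})\rangle\Big),$$ the supremum being over $\gamma\in(0,1]$, $\mathbf{x}\in\mathcal{X}$, $\mathbf{s}_n\in\mathcal{X}_n$ ($n\in\mathcal{B}$), where $\mathbf{y}_n=(1-\gamma)\mathbf{x}_n+\gamma\mathbf{s}_n$ for $n\in\mathcal{B}$ and $\mathbf{y}_n=\mathbf{x}_n$ otherwise. The expected set curvature is $\bar C_f^{B}:=\binom{N_b}{B}^{-1}\sum_{\mathcal{B}\subseteq\mathcal{N}_b,\,|\mathcal{B}|=B}C_f^{\mathcal{B}}$. It is assumed throughout that $C_f:=C_f^{\mathcal{N}_b}$ is finite (hence so are all $C_f^{\mathcal{B}}$ and $\bar C_f^{B}$). *)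

(* Defs.v *)
From HB Require Import structures.
From mathcomp Require Import all_boot all_order all_algebra.
From mathcomp Require Import all_classical all_reals all_analysis.

Set Implicit Arguments.
Unset Strict Implicit.
Unset Printing Implicit Defensive.

Import Order.TTheory GRing.Theory Num.Theory.
Import numFieldNormedType.Exports.

Local Open Scope classical_set_scope.
Local Open Scope ring_scope.

(* Vectors of R^d, d = \sum_n dim n, split into blocks of sizes dim n: the n-th
   block of x is [submxrow x n], and [\mxrow_n b n] assembles blocks. *)
Notation "''rV[' R ]_{ dim }" := 'rV[R]_(\sum_i dim i)%N
  (format "''rV[' R ]_{ dim }") : type_scope.

Definition dotp (R : realType) (m : nat) (u v : 'rV[R]_m) : R :=
  \sum_(j < m) u ord0 j * v ord0 j.

Definition gradient (R : realType) (m : nat) (f : 'rV[R]_m -> R)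
    (x : 'rV[R]_m) : 'rV[R]_m :=
  \row_(j < m) 'D_(delta_mx ord0 j) f x.

Definition block_gradient (R : realType) (Nb : nat) (dim : 'I_Nb -> nat)
    (f : 'rV[R]_{dim} -> R) (x : 'rV[R]_{dim}) (n : 'I_Nb) : 'rV[R]_(dim n) :=
  submxrow (gradient f x) n.

Definition feasible (R : realType) (Nb : nat) (dim : 'I_Nb -> nat)
    (X : forall n : 'I_Nb, set 'rV[R]_(dim n)) : set 'rV[R]_{dim} :=
  [set x | forall n : 'I_Nb, X n (submxrow x n)].

(* The blocks [s n] with n \notin S are ignored. *)
Definition block_move (R : realType) (Nb : nat) (dim : 'I_Nb -> nat)
    (S : {set 'I_Nb}) (g : R) (x : 'rV[R]_{dim})
    (s : forall n : 'I_Nb, 'rV[R]_(dim n)) : 'rV[R]_{dim} :=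
  mxrow (fun n : 'I_Nb =>
    if n \in S then (1 - g) *: submxrow x n + g *: s n else submxrow x n).

Definition linear_minimizer (R : realType) (Nb : nat) (dim : 'I_Nb -> nat)
    (X : forall n : 'I_Nb, set 'rV[R]_(dim n)) (f : 'rV[R]_{dim} -> R)
    (x : 'rV[R]_{dim}) (n : 'I_Nb) (s : 'rV[R]_(dim n)) : Prop :=
  X n s /\ forall z : 'rV[R]_(dim n), X n z ->
    dotp s (block_gradient f x n) <= dotp z (block_gradient f x n).

(* The supremum is taken in \bar R, so that it is +oo when it is not finite. *)
Definition curvature (R : realType) (Nb : nat) (dim : 'I_Nb -> nat)
    (X : forall n : 'I_Nb, set 'rV[R]_(dim n)) (f : 'rV[R]_{dim} -> R)
    (S : {set 'I_Nb}) : \bar R :=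
  ereal_sup [set c : \bar R |
    exists (g : R) (x : 'rV[R]_{dim}) (s : forall n : 'I_Nb, 'rV[R]_(dim n)),
      [/\ 0 < g <= 1, feasible X x, forall n : 'I_Nb, n \in S -> X n (s n)
        & let y := block_move S g x s in
          c = (2 / g ^+ 2 *
               (f y - f x -
                \sum_(n in S) dotp (submxrow y n - submxrow x n)
                                   (block_gradient f x n)))%:E]].

Definition expected_curvature (R : realType) (Nb : nat) (dim : 'I_Nb -> nat)
    (X : forall n : 'I_Nb, set 'rV[R]_(dim n)) (f : 'rV[R]_{dim} -> R)
    (B : nat) : \bar R :=
  (('C(Nb, B)%:R^-1)%:E *
   \sum_(S : {set 'I_Nb} | #|S| == B) curvature X f S)%E.

Definition uniform_draw (disp : measure_display) (T : measurableType disp)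
    (R : realType) (P : probability T R) (Nb B : nat)
    (D : T -> {set 'I_Nb}) : Prop :=
  forall S : {set 'I_Nb},
    measurable (D @^-1` [set S]) /\
    P (D @^-1` [set S]) = (if #|S| == B then 'C(Nb, B)%:R^-1 else 0)%:E.

Definition independent_draws (disp : measure_display) (T : measurableType disp)
    (R : realType) (P : probability T R) (Nb : nat)
    (D : nat -> T -> {set 'I_Nb}) : Prop :=
  forall (J : seq nat) (A : nat -> set {set 'I_Nb}), uniq J ->
    P (\bigcap_(t in [set` J]) (D t @^-1` A t)) =
    (\prod_(t <- J) P (D t @^-1` A t))%E.

(* [x t w] is the iterate x^t and [s t w n] the direction s_n^t along the
   outcome w.  By [ties] the direction is a function of the draws D_0, .., D_t;
   [s t w n] is unconstrained for n \notin D t w. *)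
Record block_frank_wolfe (T : Type) (R : realType) (Nb : nat)
    (dim : 'I_Nb -> nat) (X : forall n : 'I_Nb, set 'rV[R]_(dim n))
    (f : 'rV[R]_{dim} -> R) (gamma : nat -> R) (D : nat -> T -> {set 'I_Nb})
    (x0 : 'rV[R]_{dim}) (x : nat -> T -> 'rV[R]_{dim})
    (s : nat -> T -> forall n : 'I_Nb, 'rV[R]_(dim n)) : Prop := {
  start : forall w : T, x 0%N w = x0 ;
  direction : forall (t : nat) (w : T) (n : 'I_Nb), n \in D t w ->
    linear_minimizer X f (x t w) (s t w n) ;
  ties : forall (t : nat) (w w' : T),
    (forall i : nat, (i <= t)%N -> D i w = D i w') ->
    forall n : 'I_Nb, n \in D t w -> s t w n = s t w' n ;
  step : forall (t : nat) (w : T),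
    x t.+1 w = block_move (D t w) (gamma t) (x t w) (s t w) }.

(* Main.v *)
Require Import Defs.
From HB Require Import structures.
From mathcomp Require Import all_boot all_order all_algebra.
From mathcomp Require Import all_classical all_reals all_analysis.
From mathcomp Require Import ring lra.

Import Order.TTheory GRing.Theory Num.Theory.
Import numFieldNormedType.Exports.

Local Open Scope classical_set_scope.
Local Open Scope ring_scope.

(* Along any outcome, the curvature inequality and the minimality of the
   directions s_n give
     h(x^{t+1}) <= h(x^t) + g_t \sum_(n in B_t) <x*_n - x^t_n, grad_n f(x^t)>
                   + (g_t^2 / 2) C_f^{B_t}.
   The iterate x^t depends only on B_0, .., B_{t-1}, which are independent of
   B_t; averaging over B_t turns the sum over B_t into alpha times the sum over
   all blocks, which is at most - alpha h(x^t) by convexity.  Hence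
     E h(x^{t+1}) <= (1 - alpha g_t) E h(x^t) + (g_t^2 / 2) C,
   and dividing by g_t^2 telescopes thanks to the step-size condition.
   Everything is a function of finitely many finite-valued draws, so that all
   expectations are finite sums. *)

(** * Inner products, gradients and first-order convexity *)

Lemma dotpZl {R : realType} {m : nat} (a : R) (u v : 'rV[R]_m) :
  dotp (a *: u) v = a * dotp u v.
Proof. by rewrite mulr_sumr; apply: eq_bigr => j _; rewrite mxE mulrA. Qed.

Lemma dotpBl {R : realType} {m : nat} (u v w : 'rV[R]_m) :
  dotp (u - v) w = dotp u w - dotp v w.
Proof.
by rewrite -sumrB; apply: eq_bigr => j _; rewrite !mxE mulrBl.
Qed.

Lemma dotp_mulmx {R : realType} {m : nat} (u v : 'rV[R]_m) :
  dotp u v = (u *m v^T) ord0 ord0.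
Proof. by rewrite mxE; apply: eq_bigr => j _; rewrite [v^T j _]mxE. Qed.

Lemma dotp_blocks {R : realType} {Nb : nat} {dim : 'I_Nb -> nat}
    (u v : 'rV[R]_{dim}) :
  dotp u v = \sum_n dotp (submxrow u n) (submxrow v n).
Proof.
rewrite dotp_mulmx -[u in LHS]submxrowK -[v in LHS]submxrowK.
rewrite tr_mxrow mul_mxrow_mxcol summxE.
by apply: eq_bigr => n _; rewrite dotp_mulmx.
Qed.

Lemma derive_dotp_gradient {R : realType} {m : nat} (f : 'rV[R]_m -> R)
    (x v : 'rV[R]_m) :
  differentiable f x -> 'D_v f x = dotp v (gradient f x).
Proof.
move=> df; rewrite deriveE// {1}(row_sum_delta v) linear_sum.
by apply: eq_bigr => j _; rewrite linearZ mxE deriveE.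
Qed.

(** Convexity bounds the difference quotient of [f] at [x] along [y - x] by [f y - f x] for every
    step in (0, 1]; the step then tends to 0. *)
Lemma convex_gradient_le {R : realType} {m : nat} (A : set 'rV[R]_m)
    (f : 'rV[R]_m -> R) (x y : 'rV[R]_m) :
  convex_function A f -> differentiable f x -> A x -> A y ->
  dotp (y - x) (gradient f x) <= f y - f x.
Proof.
move=> cf df Ax Ay; rewrite -derive_dotp_gradient//.
have dfv : derivable f x (y - x) by exact: diff_derivable.
(* The two-sided limit is restricted to positive steps, for which the point stays on the segment
   from [x] to [y]. *)
have cv := cvg_dnbhs_at_right dfv.
rewrite -[leLHS](cvg_lim (@Rhausdorff R) cv).
apply: limr_le; first by apply/cvg_ex; eexists; exact: cv.
near=> t.
have t0 : 0 < t by near: t; exact: nbhs_right_gt.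
have t1 : t <= 1 by near: t; exact: nbhs_right_le.
have /= := cf (Itv01 (ltW t0) t1) y x (mem_set Ay) (mem_set Ax).
rewrite convRE /= /unstable.onem => cft.
rewrite /= [_ *: _]/(_ * _) ler_pdivrMl//.
have -> : t *: (y - x) + x = t *: y + (1 - t) *: x.
  by rewrite scalerBr scalerBl scale1r addrA addrAC.
rewrite (_ : t * (f y - f x) = t * f y + (1 - t) * f x - f x) ?lerB//.
by ring.
Unshelve. all: by end_near.
Qed.

(** * Block moves and curvature *)

Lemma submxrow_block_move {R : realType} {Nb : nat} {dim : 'I_Nb -> nat}
    (S : {set 'I_Nb}) (g : R) (x : 'rV[R]_{dim})
    (s : forall n : 'I_Nb, 'rV[R]_(dim n)) (n : 'I_Nb) :
  submxrow (block_move S g x s) n =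
  if n \in S then (1 - g) *: submxrow x n + g *: s n else submxrow x n.
Proof. exact: mxrowK. Qed.

Lemma feasible_block_move {R : realType} {Nb : nat} {dim : 'I_Nb -> nat}
    (X : forall n : 'I_Nb, set 'rV[R]_(dim n)) (S : {set 'I_Nb}) (g : R)
    (x : 'rV[R]_{dim}) (s : forall n : 'I_Nb, 'rV[R]_(dim n)) :
  (forall n, convex_set (X n)) -> 0 < g <= 1 -> feasible X x ->
  (forall n, n \in S -> X n (s n)) -> feasible X (block_move S g x s).
Proof.
move=> cX /andP[g0 g1] Xx Xs n; rewrite submxrow_block_move.
case: ifP => // nS; rewrite addrC.
have := cX n _ _ (Itv01 (ltW g0) g1) (mem_set (Xs _ nS)) (mem_set (Xx n)).
exact: set_mem.
Qed.

(* Idle blocks are moved towards themselves, whence C_f^S <= C_f^[set: 'I_Nb]. *)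
Lemma block_move_completed {R : realType} {Nb : nat} {dim : 'I_Nb -> nat}
    (S : {set 'I_Nb}) (g : R) (x : 'rV[R]_{dim})
    (s : forall n : 'I_Nb, 'rV[R]_(dim n)) :
  block_move [set: 'I_Nb]%SET g x (fun n => if n \in S then s n else submxrow x n)
  = block_move S g x s.
Proof.
apply/mxrowP => n; rewrite !submxrow_block_move inE; case: ifP => // _.
by rewrite -scalerDl subrK scale1r.
Qed.

(** Completing the moves shows that every value in the supremum for [S] also occurs in the one for
    all blocks, which is finite. *)
Lemma curvature_fin_num {R : realType} {Nb : nat} {dim : 'I_Nb -> nat}
    (X : forall n : 'I_Nb, set 'rV[R]_(dim n)) (f : 'rV[R]_{dim} -> R)
    (x0 : 'rV[R]_{dim}) (S : {set 'I_Nb}) :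
  feasible X x0 -> curvature X f [set: 'I_Nb]%SET \is a fin_num ->
  curvature X f S \is a fin_num.
Proof.
move=> Xx0 fT; rewrite fin_real//; apply/andP; split.
  (* Moving [x0] towards its own blocks puts a real number in the set, so the supremum is not
     -oo. *)
  apply: lt_le_trans (ereal_sup_ubound _); last first.
    by exists 1, x0, (submxrow x0); split => //; rewrite ltr01 lexx.
  exact: ltNyr.
apply: le_lt_trans (_ : _ <= curvature X f [set: 'I_Nb]%SET)%E _; last first.
  by rewrite -(fineK fT) ltry.
apply: ereal_sup_le => _ [g [x [s [g01 Xx Xs /= ->]]]].
exists g, x, (fun n => if n \in S then s n else submxrow x n); split => //.
  by move=> n _; case: ifP => [/Xs|_] //; exact: Xx.
rewrite /= block_move_completed; congr (_ * (_ - _))%:E.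
(* Idle blocks have zero displacement and add nothing to the sum over all blocks. *)
rewrite [RHS](bigID [in S])/= [X in _ + X]big1 ?addr0//.
  by apply: eq_bigl => n; rewrite inE.
move=> n /andP[_ /negPf nS]; rewrite submxrow_block_move nS subrr.
by rewrite /dotp big1// => j _; rewrite mxE mul0r.
Qed.

(** The move is itself a candidate in the supremum, and its displacement on block [n] is
    [g *: (s n - submxrow x n)]. *)
Lemma curvature_descent {R : realType} {Nb : nat} {dim : 'I_Nb -> nat}
    (X : forall n : 'I_Nb, set 'rV[R]_(dim n)) (f : 'rV[R]_{dim} -> R)
    (S : {set 'I_Nb}) (g : R) (x : 'rV[R]_{dim})
    (s : forall n : 'I_Nb, 'rV[R]_(dim n)) :
  curvature X f S \is a fin_num -> 0 < g <= 1 -> feasible X x ->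
  (forall n, n \in S -> X n (s n)) ->
  f (block_move S g x s) <=
  f x + g * \sum_(n in S) dotp (s n - submxrow x n) (block_gradient f x n)
  + g ^+ 2 / 2 * fine (curvature X f S).
Proof.
move=> fS g01 Xx Xs; have /andP[g0 _] := g01.
have : ((2 / g ^+ 2 * (f (block_move S g x s) - f x -
  \sum_(n in S) dotp (submxrow (block_move S g x s) n - submxrow x n)
                     (block_gradient f x n)))%:E <= curvature X f S)%E.
  by apply: ereal_sup_ubound; exists g, x, s.
rewrite -(fineK fS) lee_fin /= -invf_div ler_pdivrMl ?divr_gt0 ?exprn_gt0//.
rewrite !lerBlDl addrA; congr (_ <= _ + _ + _).
rewrite mulr_sumr; apply: eq_bigr => n nS.
rewrite submxrow_block_move nS -dotpZl; congr dotp.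
rewrite scalerBl scale1r scalerBr -[_ - _ *: _ + _]addrA addrAC subrr add0r.
by rewrite addrC.
Qed.

(* Comparing with the blocks of a fixed feasible z makes the right-hand side
   independent of how ties are broken. *)
Lemma frank_wolfe_descent {R : realType} {Nb : nat} {dim : 'I_Nb -> nat}
    (X : forall n : 'I_Nb, set 'rV[R]_(dim n)) (f : 'rV[R]_{dim} -> R)
    (S : {set 'I_Nb}) (g : R) (x z : 'rV[R]_{dim})
    (s : forall n : 'I_Nb, 'rV[R]_(dim n)) :
  curvature X f S \is a fin_num -> 0 < g <= 1 -> feasible X x ->
  feasible X z -> (forall n, n \in S -> linear_minimizer X f x (s n)) ->
  f (block_move S g x s) <=
  f x + g * \sum_(n in S) dotp (submxrow z n - submxrow x n) (block_gradient f x n)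
  + g ^+ 2 / 2 * fine (curvature X f S).
Proof.
move=> fS g01 Xx Xz sP; have /andP[g0 _] := g01.
apply: le_trans (curvature_descent X f S g x s fS g01 Xx _) _ => [n /sP[]//|].
rewrite lerD2r lerD2l ler_pM2l//; apply: ler_sum => n /sP[_ smin].
by rewrite !dotpBl lerD2r smin.
Qed.

(** * Counting the draws that contain a given block *)

(** Adding [x] maps the [k]-subsets of its complement bijectively onto these sets. *)
Lemma card_draws_containing {T : finType} (x : T) (k : nat) :
  #|[set A : {set T} | (x \in A) && (#|A| == k.+1)]%SET| = 'C(#|T|.-1, k).
Proof.
have -> : #|T|.-1 = #|[set~ x]%SET| by rewrite cardsC1.
rewrite -cards_draws -[RHS](card_in_imset (f := fun A => x |: A)%SET); last first.
  move=> A A'; rewrite !inE => /andP[xA _] /andP[xA' _] E.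
  have nx (C : {set T}) : C \subset [set~ x]%SET -> x \notin C.
    by move=> /fintype.subsetP sC; apply/negP => /sC; rewrite !inE eqxx.
  by rewrite -(finset.setU1K (nx _ xA)) E finset.setU1K// nx.
apply: eq_card => A; rewrite inE; apply/andP/imsetP => [[xA cA]|].
  exists (A :\ x)%SET; last by rewrite finset.setD1K.
  rewrite inE; apply/andP; split; first by apply/fintype.subsetP => y; rewrite !inE => /andP[].
  by move: cA; rewrite (cardsD1 x) xA add1n eqSS.
case=> A'; rewrite inE => /andP[sA /eqP cA] ->; split; first by rewrite !inE eqxx.
rewrite cardsU1 cA; suff -> : x \notin A' by [].
by apply/negP => /(fintype.subsetP sA); rewrite !inE eqxx.
Qed.

(** After exchanging the sums, each [a n] is counted once per draw containing [n], that is C(N-1,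
    B-1) times, and N C(N-1, B-1) = B C(N, B). *)
Lemma mean_draw_sum {R : realType} {N : nat} (B : nat) (a : 'I_N -> R) :
  (1 <= B <= N)%N ->
  'C(N, B)%:R^-1 * (\sum_(S : {set 'I_N} | #|S| == B) \sum_(n in S) a n) =
  B%:R / N%:R * \sum_n a n.
Proof.
(* From here on [B] is the draw size minus one. *)
case: B => // B /andP[_ BN].
rewrite (exchange_big_dep xpredT)//= mulr_sumr mulr_sumr; apply: eq_bigr => n _.
rewrite sumr_const [X in a n *+ X](_ : _ = 'C(N.-1, B)); last first.
  have := card_draws_containing n B; rewrite card_ord => <-.
  by apply: eq_card => S; rewrite !inE andbC.
rewrite -[a n *+ _]mulr_natl mulrA; congr (_ * _).
have N0 : N%:R != 0 :> R by rewrite pnatr_eq0 -lt0n (leq_trans _ BN).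
have C0 : 'C(N, B.+1)%:R != 0 :> R by rewrite pnatr_eq0 -lt0n bin_gt0.
apply: (mulfI N0); apply: (mulfI C0).
rewrite [N%:R * (_ / _)]mulrCA mulfV// mulr1 mulrCA !mulrA mulfK//.
by rewrite -!natrM mul_bin_diag mulnC.
Qed.

(** * Expectations of functions of a finite-valued variable *)

Lemma expectation_finite {disp : measure_display} {T : measurableType disp}
    {R : realType} (P : probability T R) {K : finType} (Z : T -> K)
    (phi : K -> R) :
  (forall k, measurable (Z @^-1` [set k])) ->
  'E_P[fun w => phi (Z w)]%E = (\sum_k phi k * fine (P (Z @^-1` [set k])))%:E.
Proof.
move=> mZ; rewrite unlock.
have iZ k : P.-integrable setT (fun w => (\1_(Z @^-1` [set k]) w)%:E).
  exact: integrable_indic.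
(* The function is a finite combination of indicators of the fibres of [Z]. *)
transitivity (\int[P]_w \sum_k ((phi k)%:E * (\1_(Z @^-1` [set k]) w)%:E))%E.
  apply: eq_integral => w _; rewrite (bigD1 (Z w))//= big1.
    by rewrite indicE mem_set// mule1 adde0.
  by move=> k kZ; rewrite indicE memNset ?mule0// => /esym/eqP; apply/negP.
rewrite integral_sum//; last by move=> k; apply: integrableZl.
rewrite -sumEFin; apply: eq_bigr => k _.
by rewrite integralZl// integral_indic// setIT EFinM fineK// fin_num_measure.
Qed.

Lemma expectation_finite_le {disp : measure_display} {T : measurableType disp}
    {R : realType} (P : probability T R) {K : finType} (Z : T -> K)
    (phi psi : K -> R) :
  (forall k, measurable (Z @^-1` [set k])) ->
  (forall w, phi (Z w) <= psi (Z w)) ->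
  ('E_P[fun w => phi (Z w)] <= 'E_P[fun w => psi (Z w)])%E.
Proof.
move=> mZ le; rewrite !expectation_finite// lee_fin; apply: ler_sum => k _.
(* The bound is known only at values taken by [Z]; any other value has an empty fibre, hence weight
   zero. *)
have [->|/set0P[w <-]] := eqVneq (Z @^-1` [set k]) set0.
  by rewrite measure0 !mulr0.
by rewrite ler_wpM2r// fine_ge0.
Qed.

(** * The history of draws and its independence of the next draw *)

(** Tuples of sets form a finite type, so the finite-sum expectations apply; the history stops
    before [D t], as the iterate at time [t] does. *)
Definition history {T : Type} {Nb : nat} (D : nat -> T -> {set 'I_Nb})
    (t : nat) (w : T) : t.-tuple {set 'I_Nb} :=
  [tuple of map (fun i => D i w) (iota 0 t)].

Lemma history_inj {T : Type} {Nb : nat} (D : nat -> T -> {set 'I_Nb})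
    (t : nat) (w w' : T) :
  history D t w = history D t w' -> forall i, (i < t)%N -> D i w = D i w'.
Proof.
move=> /(congr1 val) E i it.
have /= := congr1 (fun r => nth finset.set0 r i) E.
by rewrite !nth_mkseq.
Qed.

(** Gives the fibre the shape of the events in [independent_draws]. The default [S] of [nth] is left
    free for the choice made in [independent_history]. *)
Lemma history_preimage {T : Type} {Nb : nat} (D : nat -> T -> {set 'I_Nb})
    {t : nat} (k : t.-tuple {set 'I_Nb}) (S : {set 'I_Nb}) :
  history D t @^-1` [set k] =
  \bigcap_(i in [set` iota 0 t]) (D i @^-1` [set nth S k i]).
Proof.
apply/seteqP; split => w /=.
  by move=> <- i /=; rewrite mem_iota/= => it; rewrite nth_mkseq.
move=> kw; apply: val_inj => /=; apply: (@eq_from_nth _ S).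
  by rewrite size_map size_iota size_tuple.
move=> i; rewrite size_map size_iota => it; rewrite nth_mkseq//.
by apply: kw; rewrite /= mem_iota.
Qed.

Lemma measurable_history {disp : measure_display} {T : measurableType disp}
    {Nb : nat} (D : nat -> T -> {set 'I_Nb}) (t : nat) (k : t.-tuple {set 'I_Nb}) :
  (forall i S, measurable (D i @^-1` [set S])) ->
  measurable (history D t @^-1` [set k]).
Proof.
move=> mD; rewrite (history_preimage D k finset.set0).
exact: fin_bigcap_measurable.
Qed.

Lemma independent_history {disp : measure_display} {T : measurableType disp}
    {R : realType} (P : probability T R) {Nb : nat}
    (D : nat -> T -> {set 'I_Nb}) (t : nat) (k : t.-tuple {set 'I_Nb})
    (S : {set 'I_Nb}) :
  independent_draws P D ->
  P ((fun w => (history D t w, D t w)) @^-1` [set (k, S)]) =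
  (P (history D t @^-1` [set k]) * P (D t @^-1` [set S]))%E.
Proof.
move=> indep; pose A i := [set nth S k i].
(* [k] has length [t], so reading it at position [t] returns the default [S]: the single family [A]
   prescribes both the history and the next draw. *)
have At : A t = [set S] by rewrite /A nth_default// size_tuple.
rewrite (history_preimage D k S) (indep _ A) ?iota_uniq//.
have -> : (fun w => (history D t w, D t w)) @^-1` [set (k, S)] =
          \bigcap_(i in [set` iota 0 t.+1]) (D i @^-1` A i).
  rewrite -addn1 iotaD /= add0n; transitivity
    ((history D t @^-1` [set k]) `&` (D t @^-1` [set S])).
    by apply/seteqP; split => w /= [-> ->].
  rewrite (history_preimage D k S) -At; apply/seteqP; split => w /=.
    move=> [Aw tw] i /=; rewrite mem_cat inE => /orP[|/eqP->//].
    exact: Aw.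
  move=> Aw; split; last by apply: Aw; rewrite /= mem_cat inE eqxx orbT.
  by move=> i /= it; apply: Aw; rewrite /= mem_cat it.
rewrite indep ?iota_uniq// -addn1 iotaD big_cat /= add0n big_seq1 At.
by [].
Qed.

Lemma history_widen {T : Type} {Nb : nat} (D : nat -> T -> {set 'I_Nb})
    (t : nat) (w w' : T) :
  history D t.+1 w = history D t.+1 w' -> history D t w = history D t w'.
Proof.
move=> E; apply: val_inj; apply/eq_in_map => i; rewrite mem_iota => /= it.
by apply: (history_inj D t.+1 w w' E); exact: ltnW.
Qed.

(** Turns quantities known only outcome by outcome into functions on a finite type, by choosing a
    preimage; [v0] is the value off the range of [Z]. *)
Lemma factor_through {T K V : Type} (v0 : V) (Z : T -> K) (g : T -> V) :
  (forall w w', Z w = Z w' -> g w = g w') ->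
  exists phi : K -> V, forall w, g w = phi (Z w).
Proof.
move=> gZ; exists (fun k => if pselect (exists w, Z w = k) is left e
                            then g (sval (cid e)) else v0) => w.
case: pselect => [e|[]]; last by exists w.
by case: (cid e) => w' /= /gZ.
Qed.

(** By independence the joint law of the history and the next draw is a product, so the inner sum is
    a mean under the uniform law. *)
Lemma expectation_next_draw {disp : measure_display} {T : measurableType disp}
    {R : realType} (P : probability T R) {Nb : nat} (B : nat)
    (D : nat -> T -> {set 'I_Nb}) (t : nat)
    (psi : t.-tuple {set 'I_Nb} -> {set 'I_Nb} -> R) :
  (forall i, uniform_draw P B (D i)) -> independent_draws P D ->
  'E_P[fun w => psi (history D t w) (D t w)]%E =
  'E_P[fun w => ('C(Nb, B)%:R^-1 *
    \sum_(S : {set 'I_Nb} | #|S| == B) psi (history D t w) S)%R]%E.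
Proof.
move=> unif indep.
have mD i S : measurable (D i @^-1` [set S]) by have [] := unif i S.
have mH k : measurable (history D t @^-1` [set k]) by exact: measurable_history.
pose Z w := (history D t w, D t w).
have mZ p : measurable (Z @^-1` [set p]).
  rewrite (_ : Z @^-1` _ = (history D t @^-1` [set p.1]) `&` (D t @^-1` [set p.2])).
    exact: measurableI.
  case: p => k S; apply/seteqP; split => w.
    by case=> <- <-.
  by case=> /= <- <-.
rewrite (expectation_finite P Z (fun p => psi p.1 p.2))//.
rewrite (expectation_finite P (history D t)
  (fun k => 'C(Nb, B)%:R^-1 * \sum_(S : {set 'I_Nb} | #|S| == B) psi k S))//.
congr EFin; transitivity (\sum_k \sum_S psi k S * fine (P (Z @^-1` [set (k, S)]))).
  by rewrite pair_bigA; apply: eq_bigr => -[k S].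
apply: eq_bigr => k _; rewrite mulr_sumr mulr_suml [RHS]big_mkcond.
apply: eq_bigr => S _; rewrite independent_history// fineM ?fin_num_measure//.
have [_ ->] := unif t S; case: ifP => _ /=; last by rewrite !mulr0.
by ring.
Qed.

Lemma expectation_finite_affine {disp : measure_display}
    {T : measurableType disp} {R : realType} (P : probability T R)
    {K : finType} (Z : T -> K) (phi : K -> R) (a b : R) :
  (forall k, measurable (Z @^-1` [set k])) ->
  'E_P[fun w => (a * phi (Z w) + b)%R]%E = (a%:E * 'E_P[fun w => phi (Z w)] + b%:E)%E.
Proof.
move=> mZ; rewrite (expectation_finite P Z (fun k => a * phi k + b))//.
rewrite (expectation_finite P Z phi)// -EFinM -EFinD; congr EFin.
(* Total mass one, read off from the expectation of the constant 1; it spreads [b] over the values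
   of [Z]. *)
have [sum1] : (\sum_k 1 * fine (P (Z @^-1` [set k])))%:E = 1%:E :> \bar R.
  by rewrite -(expectation_finite P Z (fun=> 1))// expectation_cst.
rewrite -[b in RHS]mulr1 -sum1 !mulr_sumr -big_split/=.
by apply: eq_bigr => k _; ring.
Qed.

(** * Adaptedness and feasibility of the iterates *)

(** By induction: equal draws move the same blocks, and [ties] gives these blocks the same
    directions. *)
Lemma iterate_adapted {T : Type} {R : realType} {Nb : nat}
    {dim : 'I_Nb -> nat} {X : forall n : 'I_Nb, set 'rV[R]_(dim n)}
    {f : 'rV[R]_{dim} -> R} {gamma : nat -> R} {D : nat -> T -> {set 'I_Nb}}
    {x0 : 'rV[R]_{dim}} {x : nat -> T -> 'rV[R]_{dim}}
    {s : nat -> T -> forall n : 'I_Nb, 'rV[R]_(dim n)} :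
  block_frank_wolfe X f gamma D x0 x s ->
  forall t w w', (forall i, (i < t)%N -> D i w = D i w') -> x t w = x t w'.
Proof.
case=> start _ ties step; elim=> [|t IH] w w' Dw; first by rewrite !start.
rewrite !step; apply/mxrowP => n; rewrite !submxrow_block_move (Dw t)//.
have -> : x t w = x t w' by apply: IH => i it; apply: Dw; exact: ltnW.
case: ifP => // nD; congr (_ + _ *: _).
by apply: ties => [i it|]; rewrite Dw.
Qed.

Lemma feasible_iterate {T : Type} {R : realType} {Nb : nat}
    {dim : 'I_Nb -> nat} {X : forall n : 'I_Nb, set 'rV[R]_(dim n)}
    {f : 'rV[R]_{dim} -> R} {gamma : nat -> R} {D : nat -> T -> {set 'I_Nb}}
    {x0 : 'rV[R]_{dim}} {x : nat -> T -> 'rV[R]_{dim}}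
    {s : nat -> T -> forall n : 'I_Nb, 'rV[R]_(dim n)} :
  (forall n, convex_set (X n)) -> (forall t, 0 < gamma t <= 1) ->
  feasible X x0 -> block_frank_wolfe X f gamma D x0 x s ->
  forall t w, feasible X (x t w).
Proof.
move=> cX g01 Xx0 [start dir _ step]; elim=> [|t IH] w; first by rewrite start.
by rewrite step; apply: feasible_block_move => // n /dir[].
Qed.

(** * The scalar recurrence *)

(** For the quantity a_{t+1} / gamma_t^2 the step-size condition makes each step add at most C /
    2. *)
Lemma recurrence_bound {R : realType} (alpha C : R) (gamma a : nat -> R) :
  (forall t, 0 < gamma t) ->
  (forall t, (1 - alpha * gamma t.+1) / gamma t.+1 ^+ 2 <= 1 / gamma t ^+ 2) ->
  (forall t, 0 <= a t) ->
  (forall t, a t.+1 <= (1 - alpha * gamma t) * a t + gamma t ^+ 2 / 2 * C) ->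
  forall t, a t.+1 <= (1 - alpha * gamma 0%N) / gamma 0%N ^+ 2 * gamma t ^+ 2 * a 0%N
                      + t.+1%:R * C / 2 * gamma t ^+ 2.
Proof.
move=> g0 gS a0 rec.
have g2 t : 0 < gamma t ^+ 2 by rewrite exprn_gt0.
suff H : forall t, a t.+1 / gamma t ^+ 2 <=
    (1 - alpha * gamma 0%N) / gamma 0%N ^+ 2 * a 0%N + t.+1%:R * C / 2.
  move=> t; have := H t; rewrite ler_pdivrMr// => /le_trans; apply.
  by rewrite mulrDl mulrAC.
have rec' t : a t.+1 / gamma t ^+ 2 <=
    (1 - alpha * gamma t) / gamma t ^+ 2 * a t + C / 2.
  rewrite ler_pdivrMr//; apply: le_trans (rec t) _.
  have gn := lt0r_neq0 (g2 t); rewrite le_eqVlt; apply/orP; left; apply/eqP.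
  by field; apply: lt0r_neq0.
(* The base case is the recurrence at time 0, whose factor [1 - alpha * gamma 0] stays in the
   bound. *)
elim=> [|t IH]; first by rewrite mul1r.
apply: le_trans (rec' _) _.
rewrite (_ : t.+2%:R * C / 2 = t.+1%:R * C / 2 + C / 2); last first.
  by rewrite -[t.+2]addn1 natrD; ring.
(* As [a] is nonnegative, [gS] lets the coefficient of [a t.+1] grow to 1 / gamma_t^2. *)
rewrite addrA lerD2r; apply: le_trans IH; rewrite -[leRHS]mulrC.
by apply: ler_wpM2r => //; have := gS t; rewrite mul1r.
Qed.

(** * The one-step inequality in expectation *)

Lemma expected_curvature_fin {R : realType} {Nb : nat} {dim : 'I_Nb -> nat}
    (X : forall n : 'I_Nb, set 'rV[R]_(dim n)) (f : 'rV[R]_{dim} -> R) (B : nat) :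
  (forall S, curvature X f S \is a fin_num) ->
  expected_curvature X f B =
  ('C(Nb, B)%:R^-1 *
   \sum_(S : {set 'I_Nb} | #|S| == B) fine (curvature X f S))%:E.
Proof.
move=> fS; rewrite /expected_curvature EFinM -sumEFin; congr (_ * _)%E.
by apply: eq_bigr => S _; rewrite fineK.
Qed.

Lemma convex_block_gradient_le {R : realType} {Nb : nat} {dim : 'I_Nb -> nat}
    (X : forall n : 'I_Nb, set 'rV[R]_(dim n)) (f : 'rV[R]_{dim} -> R)
    (x y : 'rV[R]_{dim}) :
  convex_function (feasible X) f -> differentiable f x ->
  feasible X x -> feasible X y ->
  \sum_n dotp (submxrow y n - submxrow x n) (block_gradient f x n) <= f y - f x.
Proof.
move=> cf df Xx Xy; apply: le_trans (convex_gradient_le _ _ _ _ cf df Xx Xy).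
rewrite dotp_blocks; apply: ler_sum => n _; rewrite submxrowB.
exact: lexx.
Qed.

Lemma expected_gap_step {R : realType} {Nb B : nat} (hB : (1 <= B <= Nb)%N)
    {dim : 'I_Nb -> nat} (X : forall n : 'I_Nb, set 'rV[R]_(dim n))
    (hXconvex : forall n : 'I_Nb, convex_set (X n))
    (f : 'rV[R]_{dim} -> R)
    (hfdiff : forall x : 'rV[R]_{dim}, feasible X x -> differentiable f x)
    (hfconvex : convex_function (feasible X) f)
    (fS : forall S, curvature X f S \is a fin_num)
    (xstar : 'rV[R]_{dim}) (hxstar : feasible X xstar)
    (gamma : nat -> R) (hgamma : forall t : nat, 0 < gamma t <= 1)
    {disp : measure_display} {T : measurableType disp} (P : probability T R)
    (D : nat -> T -> {set 'I_Nb})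
    (hDuniform : forall t : nat, uniform_draw P B (D t))
    (hDindep : independent_draws P D)
    (x0 : 'rV[R]_{dim}) (hx0 : feasible X x0)
    (x : nat -> T -> 'rV[R]_{dim})
    (s : nat -> T -> forall n : 'I_Nb, 'rV[R]_(dim n))
    (halg : block_frank_wolfe X f gamma D x0 x s) (t : nat) :
  ('E_P[fun w => (f (x t.+1 w) - f xstar)%R] <=
   (1 - B%:R / Nb%:R * gamma t)%:E * 'E_P[fun w => (f (x t w) - f xstar)%R] +
   (gamma t ^+ 2 / 2)%:E * expected_curvature X f B)%E.
Proof.
set h := fun z => f z - f xstar.
have mD i S : measurable (D i @^-1` [set S]) by have [] := hDuniform i S.
have mH k : measurable (history D t @^-1` [set k]) by exact: measurable_history.
have mH' k : measurable (history D t.+1 @^-1` [set k]) by exact: measurable_history.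
have Xx := feasible_iterate hXconvex hgamma hx0 halg.
have [xi xiE] := factor_through x0 (history D t) (x t)
  (fun w w' E => iterate_adapted halg t w w' (history_inj D t w w' E)).
pose e z n := dotp (submxrow xstar n - submxrow z n) (block_gradient f z n).
(* The bound of [frank_wolfe_descent] with [z := xstar]: free of the directions, it depends on the
   next draw only through [S]. *)
pose psi (k : t.-tuple {set 'I_Nb}) (S : {set 'I_Nb}) :=
  h (xi k) + gamma t * \sum_(n in S) e (xi k) n
  + gamma t ^+ 2 / 2 * fine (curvature X f S).
apply: le_trans (_ : _ <= 'E_P[fun w => psi (history D t w) (D t w)])%E _.
  (* Both sides become functions of the longer history, so they can be compared outcome by
     outcome. *)
  have [chi chiE] := factor_through x0 (history D t.+1) (x t.+1)
    (fun w w' E => iterate_adapted halg t.+1 w w' (history_inj D t.+1 w w' E)).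
  have [rho rhoE] := factor_through 0 (history D t.+1)
    (fun w => psi (history D t w) (D t w))
    (fun w w' E => f_equal2 psi (history_widen D t w w' E)
                                (history_inj D t.+1 w w' E t (ltnSn t))).
  rewrite (_ : (fun w => h (x t.+1 w)) = (fun w => h (chi (history D t.+1 w)))); last first.
    by apply/funext => w; rewrite chiE.
  rewrite (_ : (fun w => psi _ _) = (fun w => rho (history D t.+1 w))); last first.
    exact/funext.
  apply: (expectation_finite_le P (history D t.+1) (fun k => h (chi k)) rho) => // w.
  rewrite -chiE -rhoE /psi -xiE (step halg) /h /e.
  have := frank_wolfe_descent X f (D t w) (gamma t) (x t w) xstar (s t w)
    (fS _) (hgamma t) (Xx t w) hxstar (fun n nD => direction halg nD).
  by move=> ?; lra.
(* The history is kept, and [D t] is replaced by the mean over all sets of size [B]. *)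
rewrite (expectation_next_draw P B D t psi)//.
rewrite expected_curvature_fin// -EFinM.
rewrite (_ : (fun w => h (x t w)) = (fun w => h (xi (history D t w)))); last first.
  by apply/funext => w; rewrite xiE.
rewrite -(expectation_finite_affine P (history D t) (fun k => h (xi k)))//.
pose mean_psi k := 'C(Nb, B)%:R^-1 * \sum_(S : {set 'I_Nb} | #|S| == B) psi k S.
apply: (expectation_finite_le P (history D t) mean_psi
  (fun k => (1 - B%:R / Nb%:R * gamma t) * h (xi k) + gamma t ^+ 2 / 2 *
    ('C(Nb, B)%:R^-1 *
     \sum_(S : {set 'I_Nb} | #|S| == B) fine (curvature X f S)))) => // w.
have C0 : 'C(Nb, B)%:R != 0 :> R.
  by rewrite pnatr_eq0 -lt0n bin_gt0; case/andP: hB.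
have cardB : #|(fun S : {set 'I_Nb} => #|S| == B)| = 'C(Nb, B).
  by rewrite -[X in 'C(X, _)]card_ord -card_draws; apply: eq_card => S; rewrite inE.
rewrite /mean_psi 2!big_split/= -2!mulr_sumr -xiE.
rewrite big_const cardB iter_addr_0.
set M := \sum_(S : {set 'I_Nb} | _) \sum_(n in S) _.
set Q := \sum_(S : {set 'I_Nb} | _) fine _.
(* The C(Nb, B) copies of [h (x t w)] cancel the normalisation. *)
rewrite (_ : _ * (_ + _ + _) = h (x t w) + gamma t * ('C(Nb, B)%:R^-1 * M)
  + gamma t ^+ 2 / 2 * ('C(Nb, B)%:R^-1 * Q)); last first.
  by rewrite -[h _ *+ _]mulr_natl; field.
rewrite lerD2r /M mean_draw_sum// mulrBl mul1r lerD2l.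
rewrite -mulrN [_ * gamma t]mulrC mulrA opprB.
(* Once the nonnegative factor alpha gamma_t is cancelled, there remains the convexity inequality
   from [x t w] towards [xstar]. *)
have /andP[g0 _] := hgamma t.
rewrite ler_wpM2l ?mulr_ge0 ?invr_ge0 ?(ltW g0)//.
by apply: convex_block_gradient_le => //; exact: hfdiff.
Qed.

Theorem theorem1 (R : realType) (Nb B : nat) (hNb : (1 <= Nb)%N)
    (hB : (1 <= B <= Nb)%N) (dim : 'I_Nb -> nat)
    (X : forall n : 'I_Nb, set 'rV[R]_(dim n))
    (hX0 : forall n : 'I_Nb, X n !=set0)
    (hXconvex : forall n : 'I_Nb, convex_set (X n))
    (hXcompact : forall n : 'I_Nb, compact (X n))
    (f : 'rV[R]_{dim} -> R) (U : set 'rV[R]_{dim})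
    (hUopen : open U) (hXU : feasible X `<=` U)
    (hfdiff : forall x : 'rV[R]_{dim}, U x -> differentiable f x)
    (hfconvex : convex_function (feasible X) f)
    (hCf : curvature X f [set: 'I_Nb]%SET \is a fin_num)
    (xstar : 'rV[R]_{dim}) (hxstar : feasible X xstar)
    (hmin : forall x : 'rV[R]_{dim}, feasible X x -> f xstar <= f x)
    (gamma : nat -> R) (hgamma : forall t : nat, 0 < gamma t <= 1)
    (hgammaS : forall t : nat,
       (1 - B%:R / Nb%:R * gamma t.+1) / gamma t.+1 ^+ 2 <= 1 / gamma t ^+ 2)
    (disp : measure_display) (T : measurableType disp) (P : probability T R)
    (D : nat -> T -> {set 'I_Nb})
    (hDuniform : forall t : nat, uniform_draw P B (D t))
    (hDindep : independent_draws P D)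
    (x0 : 'rV[R]_{dim}) (hx0 : feasible X x0)
    (x : nat -> T -> 'rV[R]_{dim})
    (s : nat -> T -> forall n : 'I_Nb, 'rV[R]_(dim n))
    (halg : block_frank_wolfe X f gamma D x0 x s) :
  let alpha : R := B%:R / Nb%:R in
  let h : 'rV[R]_{dim} -> R := fun z => f z - f xstar in
  forall t : nat, (1 <= t)%N ->
    ('E_P[fun w : T => h (x t w)] <=
     ((1 - alpha * gamma 0%N) / gamma 0%N ^+ 2 * gamma t.-1 ^+ 2 * h x0)%:E +
     t%:R%:E * expected_curvature X f B / 2%:E * (gamma t.-1 ^+ 2)%:E)%E.
Proof.
(* From here on [t] is the time minus one, so [gamma t.-1] reads [gamma t]. *)
move=> alpha h t; case: t => // t _.
have fS S : curvature X f S \is a fin_num by exact: (curvature_fin_num X f x0).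
have mD i S : measurable (D i @^-1` [set S]) by have [] := hDuniform i S.
have Xx := feasible_iterate hXconvex hgamma hx0 halg.
(* Finite expectations bring the recurrence from the extended reals to the reals. *)
have Efin u : 'E_P[fun w => h (x u w)]%E \is a fin_num.
  have [xi xiE] := factor_through x0 (history D u) (x u)
    (fun w w' E => iterate_adapted halg u w w' (history_inj D u w w' E)).
  rewrite (_ : (fun w => _) = (fun w => h (xi (history D u w)))).
    rewrite (expectation_finite P (history D u) (fun k => h (xi k)))// => k.
    exact: measurable_history.
  by apply/funext => w; rewrite xiE.
pose a u := fine 'E_P[fun w => h (x u w)]%E.
pose C := 'C(Nb, B)%:R^-1 *
  \sum_(S : {set 'I_Nb} | #|S| == B) fine (curvature X f S).
have a0 : a 0%N = h x0.
  rewrite /a (_ : (fun w => _) = cst (h x0)) ?expectation_cst//.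
  by apply/funext => w; rewrite (start halg).
have rec u : a u.+1 <= (1 - alpha * gamma u) * a u + gamma u ^+ 2 / 2 * C.
  rewrite -lee_fin EFinD [in leRHS]EFinM [(_ / 2 * C)%:E]EFinM /a !fineK//.
  rewrite -(expected_curvature_fin X f B fS).
  apply: (expected_gap_step hB X hXconvex f _ hfconvex fS xstar hxstar gamma
    hgamma P D hDuniform hDindep x0 hx0 x s halg) => z /hXU.
  exact: hfdiff.
rewrite expected_curvature_fin// -/C inver pnatr_eq0/= -(fineK (Efin t.+1)) -!EFinM.
rewrite -EFinD lee_fin -a0.
apply: (recurrence_bound alpha C gamma a) => // u; first by case/andP: (hgamma u).
(* Minimality of [xstar] makes the gaps nonnegative. *)
by apply: fine_ge0; apply: expectation_ge0 => w; rewrite subr_ge0 hmin.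
Qed.
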